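(* Let $\mathcal{K}$ be a Hilbert space, let $A$ be a closable, densely defined operator in $\mathcal{K}$, let $A_0$ be an operator with $A_0\subseteq A^*$, and let $(T_n)_{n=0}^\infty\subseteq\mathbf{B}(\mathcal{K})$ be a sequence converging to $I_\mathcal{K}$ in the weak operator topology such that for every $n$: (f1) the commutator $\mathrm{ad}(T_n,\bar A)=T_n\bar A-\bar AT_n$ is densely defined and bounded in $\mathcal{K}$; and (f2) $T_n^*\mathcal{D}(A^* )\subseteq\mathcal{D}(\bar A_0)$. If $$\sup_{n\in\mathbb{N}}\|\mathrm{ad}(T_n,\bar A)\|<+\infty,$$ then $\bar A_0=A^*$.
   Context: $\mathbf{B}(\mathcal{K})$ denotes the space of all bounded linear operators defined on all of $\mathcal{K}$. For operators $S,T$, $\mathrm{ad}(S,T):=ST-TS$, with sums and products of unbounded operators taken on their natural domains. $\bar S$ denotes the closure of a closable operator $S$; $\mathcal{D}(S)$ its domain. An operator $S$ is called bounded if $\|Sf\|\le c\|f\|$ for all $f\in\mathcal{D}(S)$ and some $c\ge0$, and $\|S\|$ is the supremum of $\|Sf\|$ over $f\in\mathcal{D}(S)$, $\|f\|\le1$. *)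

(* Defs.v *)
(* Hilbert space = complete normed module over
   the complex numbers R[i] equipped with an inner product compatible with
   the norm. Unbounded operators = (domain, function) pairs. *)
From HB Require Import structures.
From mathcomp Require Import all_boot all_order all_algebra.
From mathcomp Require Import all_classical all_reals all_analysis.
From mathcomp Require Import complex.
Set Implicit Arguments. Unset Strict Implicit. Unset Printing Implicit Defensive.
Import Order.TTheory GRing.Theory Num.Theory.
Import numFieldTopology.Exports numFieldNormedType.Exports.
Local Open Scope classical_set_scope.
Local Open Scope ring_scope.
Local Open Scope complex_scope.

(* inner product axioms (linear in the first argument) *)
Definition is_inner_product (R : rcfType) (K : normedModType R[i])
  (ip : K -> K -> R[i]) : Prop :=
  [/\ (forall (a : R[i]) (x y z : K), ip (a *: x + y) z = a * ip x z + ip y z),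
      (forall x y : K, ip y x = (ip x y)^*) &
      (forall x : K, ip x x = `|x| ^+ 2)].

(* a (possibly unbounded) operator in K: a domain and an action on it *)
Record op (K : Type) := Op { dom : set K ; app : K -> K }.

Section Ops.
Context {R : rcfType} {K : normedModType R[i]}.

Definition linear_op (S : op K) : Prop :=
  dom S 0 /\
  forall (a : R[i]) (x y : K), dom S x -> dom S y ->
    dom S (a *: x + y) /\ app S (a *: x + y) = a *: app S x + app S y.

Definition densely_defined (S : op K) : Prop := closure (dom S) = setT.

Definition graph (S : op K) : set (K * K) :=
  [set p | dom S p.1 /\ app S p.1 = p.2].

(* closable: the closure of the graph is again the graph of an operator *)
Definition closable (S : op K) : Prop :=
  forall x y1 y2, closure (graph S) (x, y1) -> closure (graph S) (x, y2) ->
    y1 = y2.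

(* the closure \bar S (meaningful when S is closable) *)
Definition op_closure (S : op K) : op K :=
  Op [set x | exists y, closure (graph S) (x, y)]
     (fun x => xget 0 [set y | closure (graph S) (x, y)]).

(* the adjoint S^* w.r.t. the inner product ip (for densely defined S) *)
Definition adjoint (ip : K -> K -> R[i]) (S : op K) : op K :=
  Op [set y | exists z, forall x, dom S x -> ip (app S x) y = ip x z]
     (fun y => xget 0 [set z | forall x, dom S x -> ip (app S x) y = ip x z]).

(* S ⊆ T (operator extension) *)
Definition op_incl (S T : op K) : Prop :=
  forall x, dom S x -> dom T x /\ app T x = app S x.

(* equality of operators: same domain, same action on it *)
Definition op_eq (S T : op K) : Prop :=
  dom S = dom T /\ forall x, dom S x -> app S x = app T x.

(* everywhere-defined operator given by a function *)
Definition full_op (T : K -> K) : op K := Op setT T.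

(* products and differences on natural domains *)
Definition op_mul (S T : op K) : op K :=
  Op [set x | dom T x /\ dom S (app T x)] (fun x => app S (app T x)).
Definition op_sub (S T : op K) : op K :=
  Op (dom S `&` dom T) (fun x => app S x - app T x).
Definition ad (S T : op K) : op K := op_sub (op_mul S T) (op_mul T S).

(* bounded: ||Sf|| <= c ||f|| on D(S) for some c >= 0 *)
Definition bounded_op (S : op K) : Prop :=
  exists c : R[i], 0 <= c /\ forall x, dom S x -> `|app S x| <= c * `|x|.

(* ||S|| <= M, where ||S|| = sup { ||Sf|| : f in D(S), ||f|| <= 1 } *)
Definition op_norm_le (S : op K) (M : R[i]) : Prop :=
  forall x, dom S x -> `|x| <= 1 -> `|app S x| <= M.

(* T in B(K): linear, defined on all of K, bounded *)
Definition in_BK (T : K -> K) : Prop :=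
  linear_op (full_op T) /\ bounded_op (full_op T).

(* Hilbert adjoint of a bounded everywhere defined operator *)
Definition badj (ip : K -> K -> R[i]) (T : K -> K) : K -> K :=
  app (adjoint ip (full_op T)).

(* T_n -> I in the weak operator topology *)
Definition wot_to_id (ip : K -> K -> R[i]) (T : nat -> K -> K) : Prop :=
  forall x y : K,
    (fun n => (ip (T n x) y : R[i]^o)) @ \oo --> (ip x y : R[i]^o).

End Ops.

(* Main.v *)
Require Import Defs.
From HB Require Import structures.
From mathcomp Require Import all_boot all_order all_algebra.
From mathcomp Require Import all_classical all_reals all_analysis.
From mathcomp Require Import complex.
From mathcomp Require Import ring lra.
Import Order.TTheory GRing.Theory Num.Theory.
Import numFieldTopology.Exports numFieldNormedType.Exports.
Local Open Scope classical_set_scope.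
Local Open Scope ring_scope.

Set Implicit Arguments.
Unset Strict Implicit.

(** Let [g] be in the domain of [A^*]. Each [p_n = (T_n^* g, A^* T_n^* g)] lies in
    the closed graph [G] of [A_0], and [A^* T_n^* g = T_n^* A^* g + b_n], where
    [<f, b_n> = <ad(T_n, A) f, g>] on the dense domain of the commutator. Hence
    [b_n] is bounded uniformly in [n]; as moreover [<f, b_n>] tends to [0] for
    [f] in the dense set [D(A)], [b_n] tends weakly to [0], so [p_n] tends weakly
    to [p = (g, A^* g)]. The component of [p] orthogonal to [G] is orthogonal to
    every [p_n], hence to [p], hence to itself, so [p] lies in [G].

    Everything is done with the real form [Re <x, y>], so that all estimates
    take place in [R]. *)

(** * Quadratic inequalities over an ordered field *)

Section Quadratic.
Context {R : realFieldType}.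
Implicit Types a c s q t : R.

Lemma discr_le a s q : (forall t, 0 <= s - 2 * t * a + t ^+ 2 * q) ->
  0 <= q -> a ^+ 2 <= s * q.
Proof.
move=> h; rewrite le_eqVlt => /orP[/eqP q0|q_gt0].
  have [->|a0] := eqVneq a 0; first by rewrite -q0; lra.
  (* With [q = 0] the polynomial is affine in [t], and this [t] gives it the value [-1]. *)
  have := h ((s + 1) / (2 * a)); rewrite -q0.
  have -> : s - 2 * ((s + 1) / (2 * a)) * a + ((s + 1) / (2 * a)) ^+ 2 * 0
    = - 1 by field.
  lra.
(* The quadratic attains its minimum at [a / q]. *)
have := h (a / q).
have -> : s - 2 * (a / q) * a + (a / q) ^+ 2 * q = (s * q - a ^+ 2) / q.
  by field; lra.
by rewrite pmulr_lge0 ?invr_gt0// subr_ge0.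
Qed.

(** Replaces limit arguments: Cauchy-Schwarz estimates bound a square by a fixed multiple of an
    arbitrary [e]. The sign of [c] is free, hence [|c| + 1] in the choice of [e]. *)
Lemma sqr_small_eq0 a c : (forall e, 0 < e -> a ^+ 2 <= c * e) -> a = 0.
Proof.
move=> h; apply/eqP; rewrite -sqrf_eq0; apply/eqP/le_anti.
rewrite sqr_ge0 andbT leNgt; apply/negP => a0.
have e0 : 0 < a ^+ 2 / (2 * (`|c| + 1)).
  by rewrite divr_gt0// mulr_gt0// ltr_pwDr.
have := h _ e0; apply/negP; rewrite -ltNge.
have -> : c * (a ^+ 2 / (2 * (`|c| + 1))) = a ^+ 2 * (c / (2 * (`|c| + 1))).
  by rewrite mulrCA.
rewrite -[ltRHS]mulr1 ltr_pM2l// ltr_pdivrMr ?mulr_gt0 ?ltr_pwDr//.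
by have := ler_norm c; have := normr_ge0 c; lra.
Qed.

End Quadratic.

(** * Orthogonal projection and Riesz representation for real forms *)

Section RealForm.
Context {R : realType} {V : lmodType R[i]}.

(** Scalars are real numbers embedded in [R[i]], so that the real part of the inner product on [K]
    and its direct sum on [K * K] are both instances. *)
Record real_form (b : V -> V -> R) : Prop := RealForm {
  rfD : forall x y z, b (x + y) z = b x z + b y z ;
  rfZ : forall a x z, b (a%:C%C *: x) z = a * b x z ;
  rfC : forall x y, b x y = b y x ;
  rf_ge0 : forall x, 0 <= b x x }.

Definition real_subspace (G : set V) : Prop :=
  G 0 /\ forall (a : R) (x y : V), G x -> G y -> G (a%:C%C *: x + y).

(** Cauchy sequences and limits are expressed by squared distances for [b], so no topology on [V] is
    involved. *)
Definition form_complete (b : V -> V -> R) (G : set V) : Prop :=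
  forall u : nat -> V, (forall n, G (u n)) ->
  (forall e, 0 < e -> exists N, forall n m, (N <= n)%N -> (N <= m)%N ->
     b (u n - u m) (u n - u m) < e) ->
  exists2 l, G l & forall e, 0 < e -> exists N, forall n, (N <= n)%N ->
     b (u n - l) (u n - l) < e.

Context (b : V -> V -> R) (hb : real_form b).

Lemma rfN x z : b (- x) z = - b x z.
Proof.
have -> : - x = (-1)%:C%C *: x by rewrite rmorphN rmorph1 scaleN1r.
by rewrite (rfZ hb) mulN1r.
Qed.

Lemma rfB x y z : b (x - y) z = b x z - b y z.
Proof. by rewrite (rfD hb) rfN. Qed.

Lemma rfDr x y z : b z (x + y) = b z x + b z y.
Proof. by rewrite (rfC hb) (rfD hb) !(rfC hb _ z). Qed.

Lemma rfZr a x z : b z (a%:C%C *: x) = a * b z x.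
Proof. by rewrite (rfC hb) (rfZ hb) (rfC hb). Qed.

Lemma rfBr x y z : b z (x - y) = b z x - b z y.
Proof. by rewrite (rfC hb) rfB !(rfC hb _ z). Qed.

Lemma rf0 z : b 0 z = 0.
Proof. by rewrite -(subrr 0) rfB subrr. Qed.

Lemma rfBC x y : b (x - y) (x - y) = b (y - x) (y - x).
Proof. by rewrite -(opprB y x) rfN (rfC hb) rfN opprK. Qed.

Lemma rf_subZ t x y : b (x - t%:C%C *: y) (x - t%:C%C *: y) =
  b x x - 2 * t * b x y + t ^+ 2 * b y y.
Proof.
by rewrite rfB !rfBr !(rfZ hb) !rfZr (rfC hb y x); ring.
Qed.

Lemma rf_Cauchy_Schwarz x y : b x y ^+ 2 <= b x x * b y y.
Proof.
apply: discr_le => [t|]; last exact: rf_ge0.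
by rewrite -rf_subZ (rf_ge0 hb).
Qed.

Lemma rf_sqrD_le x y : b (x + y) (x + y) <= 2 * (b x x + b y y).
Proof.
have := rf_ge0 hb (x - y).
by rewrite rfB !rfBr (rfD hb) !rfDr (rfC hb y x); lra.
Qed.

Lemma rf_dist_le y x z :
  b (x - z) (x - z) <= 2 * (b (x - y) (x - y) + b (y - z) (y - z)).
Proof.
have -> : x - z = (x - y) + (y - z) by rewrite addrA subrK.
exact: rf_sqrD_le.
Qed.

(** A minimising sequence for the distance from [p] to [G] is Cauchy, and its limit is the
    projection. Both facts follow from the approximate orthogonality [orth], in place of the
    parallelogram law. *)
Lemma projection_exists (G : set V) (p : V) :
  real_subspace G -> form_complete b G ->
  exists2 w, G w & forall v, G v -> b (p - w) v = 0.
Proof.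
move=> [G0 Glin] Gcomp.
pose E := [set b (p - w) (p - w) | w in G].
have Elb : has_lbound E by exists 0 => _ [w _ <-]; exact: rf_ge0.
have Einf : has_inf E by split => //; exists (b (p - 0) (p - 0)), 0.
pose d := inf E.
have dle w : G w -> d <= b (p - w) (p - w).
  by move=> Gw; apply: ge_inf => //; exists w.
(* [w + t v] ranges over [G], so the excess over the infimum controls how far
   [p - w] is from being orthogonal to [G]. *)
have orth w v : G w -> G v ->
    b (p - w) v ^+ 2 <= (b (p - w) (p - w) - d) * b v v.
  move=> Gw Gv; apply: discr_le => [t|]; last exact: rf_ge0.
  have := dle _ (Glin t _ _ Gv Gw).
  have -> : p - (t%:C%C *: v + w) = (p - w) - t%:C%C *: v.
    by rewrite opprD addrA addrAC.
  by rewrite rf_subZ; lra.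
have /choice[u hu] (n : nat) : exists w, G w /\
    b (p - w) (p - w) < d + n.+1%:R^-1.
  have n0 : 0 < n.+1%:R^-1 :> R by rewrite invr_gt0.
  by have [_ [w Gw <-] hw] := inf_adherent n0 Einf; exists w.
have inv_small (e : R) : 0 < e -> exists N, forall n, (N <= n)%N ->
    n.+1%:R^-1 < e.
  move=> e0; have [N _ hN] := near_infty_natSinv_lt (PosNum e0).
  by exists N => n Nn; exact: hN.
have GB x y : G x -> G y -> G (x - y).
  move=> Gx Gy; have := Glin (-1) _ _ Gy Gx.
  by rewrite rmorphN rmorph1 scaleN1r addrC.
have [||l Gl hl] := Gcomp u.
- by move=> n; case: (hu n).
- move=> e e0; have e4 : 0 < e / 4 by lra.
  have [N hN] := inv_small _ e4; exists N => n m Nn Nm.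
  have [Gn hn] := hu n; have [Gm hm] := hu m.
  have := hN _ Nn; have := hN _ Nm; have Gnm := GB _ _ Gn Gm.
  have := orth _ _ Gn Gnm; have := orth _ _ Gm Gnm.
  have := rf_ge0 hb (u n - u m).
  (* The difference [u n - u m] lies in [G], so [orth] bounds the squares of both terms by
     [e / 4 * q]. Then [q * q < e * q], and [q] cancels unless it is zero. *)
  have : b (u n - u m) (u n - u m) =
      b (p - u m) (u n - u m) - b (p - u n) (u n - u m).
    by rewrite -rfB; congr (b _ _); rewrite opprB [RHS]addrC addrA subrK.
  set q := b (u n - u m) _; set x := b (p - u m) (u n - u m).
  set y := b (p - u n) (u n - u m).
  move: hn hm; set s := b (p - u n) _; set s' := b (p - u m) _.
  set i := n.+1%:R^-1; set j := m.+1%:R^-1 => hn hm qE q0 hx hy hi hj.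
  have [->//|qn0] := eqVneq q 0.
  have q_gt0 : 0 < q by rewrite lt_def qn0.
  rewrite -(ltr_pM2r q_gt0).
  have : q * q <= 2 * (x ^+ 2 + y ^+ 2).
    rewrite qE -subr_ge0.
    have -> : 2 * (x ^+ 2 + y ^+ 2) - (x - y) * (x - y) = (x + y) ^+ 2 by ring.
    exact: sqr_ge0.
  have : (s - d) * q < e / 4 * q by rewrite ltr_pM2r//; lra.
  have : (s' - d) * q < e / 4 * q by rewrite ltr_pM2r//; lra.
  lra.
- exists l => // v Gv; apply: (@sqr_small_eq0 _ _ (4 * b v v)) => e e0.
  have [N hN] := inv_small _ e0; have [M hM] := hl _ e0.
  pose n := maxn N M.
  have := hN n (leq_maxl _ _); have := hM n (leq_maxr _ _).
  have [Gn] := hu n; have := orth _ _ Gn Gv.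
  have := rf_Cauchy_Schwarz (u n - l) v.
  (* The first term is controlled by [orth], the second by Cauchy-Schwarz; each square is at most
     [e * b v v], whence the factor 4. *)
  have -> : b (p - l) v = b (p - u n) v + b (u n - l) v.
    by rewrite -(rfD hb) addrA subrK.
  have := rf_ge0 hb v.
  set x := b (p - u n) v; set y := b (u n - l) v; set q := b v v.
  set s := b (p - u n) _; set s' := b (u n - l) _; set i := n.+1%:R^-1.
  move=> q0 hy hx hs hs' hi.
  have : (x + y) ^+ 2 <= 2 * (x ^+ 2 + y ^+ 2).
    rewrite -subr_ge0.
    have -> : 2 * (x ^+ 2 + y ^+ 2) - (x + y) ^+ 2 = (x - y) ^+ 2 by ring.
    exact: sqr_ge0.
  have : (s - d) * q <= e * q by rewrite ler_wpM2r//; lra.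
  have : s' * q <= e * q by rewrite ler_wpM2r//; lra.
  lra.
Qed.

(** Take [p] outside the kernel of [f] and subtract its projection onto that kernel: the residual
    [r] represents [f] up to a scalar. The bound by [c] makes the kernel complete and forces [b r r]
    to be nonzero. *)
Lemma real_Riesz (f : V -> R) (c : R) :
  form_complete b setT ->
  (forall x y, f (x + y) = f x + f y) ->
  (forall a x, f (a%:C%C *: x) = a * f x) ->
  (forall x, f x ^+ 2 <= c * b x x) ->
  exists z, forall x, f x = b x z.
Proof.
move=> Vcomp fD fZ fle.
have fN x : f (- x) = - f x.
  have -> : - x = (-1)%:C%C *: x by rewrite rmorphN rmorph1 scaleN1r.
  by rewrite fZ mulN1r.
have [f0|] := pselect (forall x, f x = 0).
  by exists 0 => x; rewrite f0 (rfC hb) rf0.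
move=> /existsNP[p /eqP fp0].
have [||w fw hw] := @projection_exists [set x | f x = 0] p.
- split => [|a x y /= fx fy]; last by rewrite fD fZ fx fy mulr0 addr0.
  by have /= := fD 0 0; rewrite addr0; lra.
- move=> u fu /(Vcomp u (fun=> I))[l _ hl]; exists l => //=.
  apply: (@sqr_small_eq0 _ _ (`|c|)) => e e0.
  have [N hN] := hl _ e0; have := hN _ (leqnn N).
  have := fle (u N - l); have := rf_ge0 hb (u N - l).
  rewrite fD fN (fu N) add0r sqrrN.
  have := ler_norm c; have := normr_ge0 c.
  set q := b _ _ => ? ? ? ? ?.
  apply: (@le_trans _ _ (c * q)) => //.
  apply: (@le_trans _ _ (`|c| * q)); first exact: ler_wpM2r.
  by apply: ler_wpM2l => //; lra.
rewrite /= in fw hw; set r := p - w in hw.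
have fr : f r = f p by rewrite /r fD fN fw subr0.
have rr : b r r = b p r by rewrite {1}/r rfB (rfC hb w) hw// subr0.
(* The vector [f p * x - f x * p] lies in the kernel, hence is orthogonal to [r]. *)
have key x : f x * b r r = f p * b x r.
  have /hw : f ((f p)%:C%C *: x + (- f x)%:C%C *: p) = 0.
    by rewrite fD !fZ; ring.
  by rewrite (rfC hb) (rfD hb) !(rfZ hb) rr; lra.
have r0 : b r r != 0.
  apply/eqP => r0; have := fle r; rewrite r0 mulr0 fr => h.
  have : f p ^+ 2 = 0 by apply/le_anti; rewrite h sqr_ge0.
  by move/eqP; rewrite sqrf_eq0 (negbTE fp0).
exists ((f p / b r r)%:C%C *: r) => x; rewrite rfZr.
by apply: (mulIf r0); rewrite key; field.
Qed.

End RealForm.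

(** * The real part of the inner product, its topology and density *)

Section Hilbert.
Context {R : realType} {K : completeNormedModType R[i]}.
Context (ip : K -> K -> R[i]) (hip : is_inner_product ip).
Implicit Types (x y z v w : K) (S : op K) (e s : R).

Definition rip x y : R := complex.Re (ip x y).

Lemma ip0 v : ip 0 v = 0.
Proof.
have [ipl _ _] := hip; have := ipl (-1) 0 0 v.
by rewrite scaler0 addr0 mulN1r addNr.
Qed.

Lemma ipZ a x v : ip (a *: x) v = a * ip x v.
Proof.
by have [ipl _ _] := hip; have := ipl a x 0 v; rewrite addr0 ip0 addr0.
Qed.

Lemma rip_form : real_form rip.
Proof.
have [ipl ipC ipn] := hip; rewrite /rip; split.
- move=> x y z; have := ipl 1 x y z; rewrite scale1r mul1r => ->.
  by case: (ip x z) (ip y z) => ? ? [].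
- move=> a x z; rewrite ipZ.
  by case: (ip x z) => c d /=; rewrite mul0r subr0.
- by move=> x y; rewrite (ipC y x); case: (ip y x).
- move=> x; have : 0 <= ip x x by rewrite ipn exprn_ge0.
  by rewrite lecE => /andP[].
Qed.

Let rf := rip_form.

Lemma sqr_norm_rip x : `|x| ^+ 2 = (rip x x)%:C%C.
Proof.
by have [_ _ ipn] := hip; rewrite /rip ipn RRe_real//.
Qed.

Lemma norm_rip_lt x e : 0 < e -> (`|x| < e%:C%C) = (rip x x < e ^+ 2).
Proof.
move=> e0; rewrite -ltcR -sqr_norm_rip rmorphXn /=.
by rewrite ltr_pXn2r // nnegrE ?normr_ge0 ?ler0c ?(ltW e0).
Qed.

Lemma norm_rip_le x e : 0 <= e -> (`|x| <= e%:C%C) = (rip x x <= e ^+ 2).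
Proof.
move=> e0; rewrite -lecR -sqr_norm_rip rmorphXn /=.
by rewrite ler_pXn2r // nnegrE ?normr_ge0 ?ler0c.
Qed.

Lemma rip_eq0 x : rip x x = 0 -> x = 0.
Proof.
by move=> h; apply/eqP; rewrite -normr_eq0 -sqrf_eq0 sqr_norm_rip h.
Qed.

(* [Im z = Re (- i z)], so the real part of the inner product determines it. *)
Lemma ip_eq x y z w : rip x y = rip z w ->
  rip ('i%C *: x) y = rip ('i%C *: z) w -> ip x y = ip z w.
Proof.
rewrite /rip !ipZ; case: (ip x y) (ip z w) => a c [a' c'] /= -> h.
by congr Complex; lra.
Qed.

Lemma rip_complete : form_complete rip setT.
Proof.
move=> u _ hu.
have cu : cvg (u @ \oo).
  apply: cauchy_cvg; apply: cauchy_exP => e e0.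
  (* Positive elements of [R[i]] are real, so radii can be taken in [R]. *)
  have [r re] : exists r, e = r%:C%C.
    by apply/complex_realP/ger0_real/ltW.
  rewrite {}re ltcR in e0 *.
  have r2 : 0 < r ^+ 2 by rewrite exprn_gt0.
  have [N hN] := hu _ r2; exists (u N); exists N => // n /= Nn.
  by rewrite -ball_normE /= norm_rip_lt// hN.
exists (lim (u @ \oo)) => // e e0.
have se : 0 < Num.sqrt e by rewrite sqrtr_gt0.
have se' : 0 < (Num.sqrt e)%:C%C by rewrite ltcR.
have /cvgrPdist_lt/(_ _ se')[N _ hN] := cu.
exists N => n Nn; have := hN n Nn.
rewrite /= norm_rip_lt// sqr_sqrtr ?(ltW e0)//.
by rewrite (rfBC rf).
Qed.

(** Balls of [K * K] are products of balls of equal radius, so a single [e], the squared radius,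
    serves both components. *)
Lemma closure_graphP S x y : closure (graph S) (x, y) <->
  forall e, 0 < e -> exists x', [/\ dom S x', rip (x - x') (x - x') < e &
    rip (y - app S x') (y - app S x') < e].
Proof.
split=> [h e e0|h B].
  have se : 0 < Num.sqrt e by rewrite sqrtr_gt0.
  have se' : 0 < (Num.sqrt e)%:C%C by rewrite ltcR.
  have /h : nbhs (x, y) (ball (x, y) (Num.sqrt e)%:C%C).
    by apply/nbhs_ballP; exists (Num.sqrt e)%:C%C.
  move=> [[x' y'] [[/= dx <-] [/=]]]; rewrite -!ball_normE /= !norm_rip_lt//.
  by rewrite sqr_sqrtr ?(ltW e0)// => ? ?; exists x'.
move=> /nbhs_ballP[e /= e0 hB].
have [r re] : exists r, e = r%:C%C by apply/complex_realP/ger0_real/ltW.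
rewrite {}re ltcR in e0 hB.
have r2 : 0 < r ^+ 2 by rewrite exprn_gt0.
have [x' [dx h1 h2]] := h _ r2; exists (x', app S x'); split => //.
by apply: hB; split; rewrite -ball_normE /= norm_rip_lt.
Qed.

Definition rip_dense (D : set K) : Prop :=
  forall x e, 0 < e -> exists2 x', D x' & rip (x - x') (x - x') < e.

Lemma densely_defined_rip S : densely_defined S -> rip_dense (dom S).
Proof.
move=> h x e e0.
have se : 0 < Num.sqrt e by rewrite sqrtr_gt0.
have se' : 0 < (Num.sqrt e)%:C%C by rewrite ltcR.
have : closure (dom S) x by rewrite h.
have nx : nbhs x (ball x (Num.sqrt e)%:C%C).
  by apply/nbhs_ballP; exists (Num.sqrt e)%:C%C.
move=> /(_ _ nx)[x' [dx]]; rewrite -ball_normE /= norm_rip_lt// => h'.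
by exists x' => //; rewrite sqr_sqrtr// ltW in h'.
Qed.

Lemma rip_dense_eq0 (D : set K) v : rip_dense D ->
  (forall x, D x -> rip x v = 0) -> v = 0.
Proof.
move=> hD h; apply: rip_eq0; apply: (@sqr_small_eq0 _ _ (rip v v)) => e e0.
(* Approximating [v] itself by [x] gives [rip v v = rip (v - x) v], which is small. *)
have [x Dx hx] := hD v _ e0.
have := rf_Cauchy_Schwarz rf (v - x) v; rewrite (rfB rf) (h _ Dx) subr0.
move=> /le_trans; apply; rewrite mulrC; apply: ler_wpM2l (ltW hx).
exact: (rf_ge0 rf).
Qed.

(** * Closed graphs in the direct sum, and adjoints *)

Lemma closure_graph_subspace S : linear_op S ->
  real_subspace (closure (graph S) : set (K * K)).
Proof.
move=> [S0 Slin]; split.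
  apply: subset_closure; split => //=.
  have [_] := Slin (-1) _ _ S0 S0.
  by rewrite !scaleN1r !addNr.
move=> a [x1 y1] [x2 y2] /closure_graphP h1 /closure_graphP h2.
apply/closure_graphP => e e0.
(* Chosen so that the bound [2 * (a ^+ 2 * d + d)] coming from [rf_sqrD_le] equals [e / 2]. *)
pose d := e / (4 * (a ^+ 2 + 1)).
have a0 : 0 < a ^+ 2 + 1 by rewrite ltr_pwDr// sqr_ge0.
have d0 : 0 < d by rewrite divr_gt0// mulr_gt0.
have de : 2 * (a ^+ 2 * d + d) < e.
  have -> : 2 * (a ^+ 2 * d + d) = e / 2 by rewrite /d; field; lra.
  lra.
have est x x' y y' : rip (x - x') (x - x') < d -> rip (y - y') (y - y') < d ->
    rip (a%:C%C *: x + y - (a%:C%C *: x' + y'))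
        (a%:C%C *: x + y - (a%:C%C *: x' + y')) < e.
  move=> hx hy; have -> : a%:C%C *: x + y - (a%:C%C *: x' + y') =
      a%:C%C *: (x - x') + (y - y').
    by rewrite scalerBr opprD addrACA.
  apply: le_lt_trans (rf_sqrD_le rf _ _) _.
  rewrite (rfZ rf) (rfZr rf) mulrA -expr2.
  have : a ^+ 2 * rip (x - x') (x - x') <= a ^+ 2 * d.
    by apply: ler_wpM2l (ltW hx); exact: sqr_ge0.
  lra.
have [x1' [dx1 hx1 hy1]] := h1 _ d0.
have [x2' [dx2 hx2 hy2]] := h2 _ d0.
have [dx Sx] := Slin a%:C%C _ _ dx1 dx2.
by exists (a%:C%C *: x1' + x2'); split=> //=; rewrite ?Sx; exact: est.
Qed.

(** The real inner product of the Hilbert direct sum, in which closed graphs are complete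
    subspaces. *)
Definition pair_form (u v : K * K) : R := rip u.1 v.1 + rip u.2 v.2.

Lemma pair_form_real_form : real_form pair_form.
Proof.
rewrite /pair_form; split => [x y z|a x z|x y|x] /=.
- by rewrite !(rfD rf); lra.
- by rewrite !(rfZ rf); lra.
- by rewrite (rfC rf) (rfC rf x.2).
- by rewrite addr_ge0// (rf_ge0 rf).
Qed.

Lemma closure_graph_complete S : form_complete pair_form (closure (graph S)).
Proof.
move=> u hu cu.
have pos x : 0 <= rip x x by exact: rf_ge0.
have [|l1 _ hl1] := @rip_complete (fun n => (u n).1) (fun=> I).
  move=> e e0; have [N hN] := cu _ e0; exists N => n m Nn Nm.
  have := hN _ _ Nn Nm; rewrite /pair_form /=.
  by have := pos ((u n).2 - (u m).2); lra.
have [|l2 _ hl2] := @rip_complete (fun n => (u n).2) (fun=> I).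
  move=> e e0; have [N hN] := cu _ e0; exists N => n m Nn Nm.
  have := hN _ _ Nn Nm; rewrite /pair_form /=.
  by have := pos ((u n).1 - (u m).1); lra.
have conv e : 0 < e -> exists N, forall n, (N <= n)%N ->
    rip ((u n).1 - l1) ((u n).1 - l1) < e /\
    rip ((u n).2 - l2) ((u n).2 - l2) < e.
  move=> e0; have [N1 h1] := hl1 _ e0; have [N2 h2] := hl2 _ e0.
  exists (maxn N1 N2) => n; rewrite geq_max => /andP[n1 n2].
  by split; [exact: h1|exact: h2].
exists (l1, l2).
  apply/closure_graphP => e e0; have e4 : 0 < e / 4 by lra.
  have [N /(_ N (leqnn _))[c1 c2]] := conv _ e4.
  have := hu N; rewrite (surjective_pairing (u N)).
  move=> /closure_graphP/(_ _ e4)[x' [dx h1 h2]].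
  exists x'; split => //.
    apply: le_lt_trans (rf_dist_le rf (u N).1 _ _) _.
    by rewrite (rfBC rf l1); lra.
  apply: le_lt_trans (rf_dist_le rf (u N).2 _ _) _.
  by rewrite (rfBC rf l2); lra.
move=> e e0; have e2 : 0 < e / 2 by lra.
have [N hN] := conv _ e2; exists N => n /hN[c1 c2].
by rewrite /pair_form /=; lra.
Qed.

(** The graph of the adjoint as a relation, free of the choice operator in [adjoint] and of complex
    values. *)
Definition adjoint_rel S y z : Prop :=
  forall x, dom S x -> rip (app S x) y = rip x z.

(** The real identity at [x] and at [i x] yields the complex one; density makes [z] unique, so the
    value picked by [xget] is [z]. *)
Lemma adjointP S y z : linear_op S -> rip_dense (dom S) ->
  (dom (adjoint ip S) y /\ app (adjoint ip S) y = z) <-> adjoint_rel S y z.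
Proof.
move=> [S0 Slin] Sd; split => [[dy <-] x dx|h].
  by have := xgetPex 0 dy x dx; rewrite /rip => ->.
have SZ a x : dom S x -> dom S (a *: x) /\ app S (a *: x) = a *: app S x.
  move=> dx; have [_] := Slin (-1) _ _ S0 S0; rewrite !scaleN1r !addNr => s0.
  by have := Slin a _ _ dx S0; rewrite !addr0 s0 addr0.
have ipz x : dom S x -> ip (app S x) y = ip x z.
  move=> dx; apply: ip_eq; first exact: h.
  by have [dix <-] := SZ 'i%C _ dx; exact: h.
have dy : dom (adjoint ip S) y by exists z.
split => //; apply/eqP; rewrite -subr_eq0; apply/eqP.
apply: (rip_dense_eq0 Sd) => x dx; rewrite (rfBr rf).
by have /= := xgetPex 0 dy x dx; rewrite ipz// /rip => <-; rewrite subrr.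
Qed.

Lemma op_closureP S x y : closable S ->
  (dom (op_closure S) x /\ app (op_closure S) x = y) <->
  closure (graph S) (x, y).
Proof.
move=> cS; split => [[dx <-]|h]; first exact: (xgetPex 0 dx).
have dx : dom (op_closure S) x by exists y.
by split => //; apply: cS h; exact: (xgetPex 0 dx).
Qed.

(** Both sides are continuous in [(x, w)], so the adjoint identity passes from the graph to its
    closure. *)
Lemma closure_graph_rip S x w y z : closure (graph S) (x, w) ->
  adjoint_rel S y z -> rip w y = rip x z.
Proof.
move=> /closure_graphP h hyz; apply/eqP; rewrite -subr_eq0; apply/eqP.
apply: (@sqr_small_eq0 _ _ (2 * (rip y y + rip z z))) => e e0.
have [x' [dx h1 h2]] := h _ e0.
have -> : rip w y - rip x z = rip (w - app S x') y - rip (x - x') z.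
  by rewrite !(rfB rf) (hyz _ dx); lra.
have := rf_Cauchy_Schwarz rf (w - app S x') y.
have := rf_Cauchy_Schwarz rf (x - x') z.
have := ler_wpM2r (rf_ge0 rf y) (ltW h2).
have := ler_wpM2r (rf_ge0 rf z) (ltW h1).
set a := rip (w - _) y; set c := rip (x - _) z => ? ? ? ?.
have := sqr_ge0 (a + c).
have -> : (a + c) ^+ 2 = 2 * (a ^+ 2 + c ^+ 2) - (a - c) ^+ 2 by ring.
lra.
Qed.

(** Riesz representation of [rip (T x) y] as a functional of [x] shows that [y] is in the domain of
    the adjoint, so that [xget] does not return its default 0. *)
Lemma badjP (T : K -> K) : in_BK T -> forall x y,
  rip (T x) y = rip x (badj ip T y).
Proof.
move=> [Tlin [c [c0 Tc]]] x y.
have [r cr] : exists r, c = r%:C%C by apply/complex_realP/ger0_real.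
rewrite {}cr ler0c in c0 Tc.
have TB u : rip (T u) (T u) <= r ^+ 2 * rip u u.
  rewrite -lecR rmorphM rmorphXn /= -!sqr_norm_rip -exprMn.
  by rewrite ler_pXn2r ?nnegrE ?mulr_ge0 ?ler0c//; exact: Tc.
have TZ a u v : T (a *: u + v) = a *: T u + T v.
  by have [_ /(_ a u v I I)[]] := Tlin.
have TD u v : T (u + v) = T u + T v.
  by have := TZ 1 u v; rewrite !scale1r.
have T0 : T 0 = 0 by have := TZ (-1) 0 0; rewrite !scaleN1r !addNr.
have [|||z hz] := @real_Riesz _ _ _ rf (fun u => rip (T u) y) (r ^+ 2 * rip y y)
  rip_complete.
- by move=> u v; rewrite TD (rfD rf).
- move=> a u; have := TZ a%:C%C u 0; rewrite !addr0 T0 addr0 => ->.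
  by rewrite (rfZ rf).
- move=> u; apply: le_trans (rf_Cauchy_Schwarz rf _ _) _.
  by rewrite mulrAC; apply: ler_wpM2r (TB u); exact: rf_ge0.
have fd : rip_dense (dom (full_op T)).
  by move=> u e e0; exists u => //; rewrite subrr (rf0 rf).
have [] : dom (adjoint ip (full_op T)) y /\ badj ip T y = z.
  by apply/(adjointP y z Tlin fd) => u _; exact: hz.
by move=> _ ->; exact: hz.
Qed.

(** * Weak convergence and the commutator bound *)

Lemma wot_rip (T : nat -> K -> K) x y : wot_to_id ip T ->
  rip (T n x) y @[n --> \oo] --> rip x y.
Proof.
move=> /(_ x y)/cvgrPdist_lt h; apply/cvgrPdist_lt => e e0.
have e0' : 0 < e%:C%C by rewrite ltcR.
have [N _ hN] := h _ e0'; exists N => // n Nn.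
rewrite -ltcR; apply: le_lt_trans (hN _ Nn).
apply: le_trans (normc_ge_Re _); rewrite lecR /rip.
by case: (ip x y) (ip (T n x) y) => ? ? [].
Qed.

Lemma rip_weak_null (D : set K) (u : nat -> K) c : rip_dense D ->
  (forall n, rip (u n) (u n) <= c) ->
  (forall x, D x -> rip (u n) x @[n --> \oo] --> (0 : R)) ->
  forall v, rip (u n) v @[n --> \oo] --> (0 : R).
Proof.
move=> hD uc uD v; apply/cvgrPdist_lt => e e0.
have c0 : 0 <= c by apply: le_trans (uc 0%N); exact: rf_ge0.
(* Times [c + 1] this is the square of [e / 2]; adding 1 avoids division by zero when [c = 0]. *)
have d0 : 0 < e ^+ 2 / (4 * (c + 1)).
  by rewrite divr_gt0 ?exprn_gt0// mulr_gt0// ltr_pwDr.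
have [x Dx hx] := hD v _ d0; have e2 : 0 < e / 2 by lra.
have /cvgrPdist_lt/(_ _ e2)[N _ hN] := uD _ Dx.
exists N => // n /hN /=; rewrite !sub0r !normrN => h1.
have -> : rip (u n) v = rip (u n) x + rip (u n) (v - x).
  by rewrite (rfBr rf); lra.
apply: le_lt_trans (ler_normD _ _) _.
suff : `|rip (u n) (v - x)| <= e / 2 by lra.
rewrite -(ler_pXn2r (_ : 0 < 2)%N)// ?nnegrE ?(ltW e2)// real_normK ?num_real//.
apply: le_trans (rf_Cauchy_Schwarz rf _ _) _.
apply: (@le_trans _ _ ((c + 1) * (e ^+ 2 / (4 * (c + 1))))).
  apply: ler_pM (ltW hx); try exact: rf_ge0.
  by have := uc n; lra.
by rewrite le_eqVlt; apply/orP; left; apply/eqP; field; lra.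
Qed.

(** The norm bound concerns the unit ball, so [x] is scaled by the inverse square root of [s]. Any
    positive [s] above [rip x x] will do, which covers [x = 0] as well. *)
Lemma ad_closure_bound S (T : K -> K) (M : R[i]) :
  linear_op S -> closable S -> in_BK T ->
  op_norm_le (ad (full_op T) (op_closure S)) M ->
  forall x y z s, 0 < s -> rip x x <= s -> closure (graph S) (x, y) ->
  closure (graph S) (T x, z) ->
  rip (T y - z) (T y - z) <= complex.Re M ^+ 2 * s.
Proof.
move=> Slin Sc [[_ Tlin] _] hM x y z s s0 xs hxy hTz.
have TZ a u : T (a *: u) = a *: T u.
  have [_ /=] := Tlin (-1) 0 0 I I; rewrite !scaleN1r !addNr => T0.
  by have [_ /=] := Tlin a u 0 I I; rewrite T0 !addr0.
have [G0 Glin] := closure_graph_subspace Slin.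
pose t := (Num.sqrt s)^-1.
have t2 : t ^+ 2 * s = 1.
  by rewrite exprVn sqr_sqrtr ?(ltW s0)// mulVf// gt_eqF.
have GZ u v : closure (graph S) (u, v) ->
    closure (graph S) (t%:C%C *: u, t%:C%C *: v).
  move=> h; have := Glin t (u, v) 0 h G0.
  by rewrite addr0.
have [dx Sx] := (op_closureP _ _ Sc).2 (GZ _ _ hxy).
have := GZ _ _ hTz; rewrite -TZ => /(op_closureP _ _ Sc)[dTx STx].
have tx : `|t%:C%C *: x| <= 1.
  rewrite (_ : 1 = (1 : R)%:C%C)// norm_rip_le// (rfZ rf) (rfZr rf) mulrA.
  rewrite -expr2 expr1n -t2; apply: ler_wpM2l xs; exact: sqr_ge0.
have dad : dom (ad (full_op T) (op_closure S)) (t%:C%C *: x) by [].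
have := hM _ dad tx.
have -> : app (ad (full_op T) (op_closure S)) (t%:C%C *: x) =
    T (app (op_closure S) (t%:C%C *: x)) - app (op_closure S) (T (t%:C%C *: x)).
  by [].
rewrite Sx STx TZ -scalerBr => h.
(* The complex number [M] dominates a norm, hence is real and nonnegative. *)
have M0 : 0 <= M by apply: le_trans h.
have Mr : M = (complex.Re M)%:C%C by rewrite RRe_real// ger0_real.
have rM0 : 0 <= complex.Re M by rewrite -ler0c -Mr.
move: h; rewrite {1}Mr norm_rip_le// (rfZ rf) (rfZr rf) mulrA -expr2 => h.
rewrite -[leLHS]mul1r -t2 mulrAC ler_pM2r//.
Qed.

End Hilbert.

(** * Equality of the closure of [A0] with the adjoint of [A] *)

Theorem theorem3 (R : realType) (K : completeNormedModType R[i])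
  (ip : K -> K -> R[i]) (hip : is_inner_product ip)
  (A A0 : op K) (T : nat -> K -> K)
  (hA_lin : linear_op A) (hA_dense : densely_defined A) (hA_clos : closable A)
  (hA0_lin : linear_op A0) (hA0 : op_incl A0 (adjoint ip A))
  (hT : forall n, in_BK (T n)) (hTw : wot_to_id ip T)
  (f1_dense : forall n, densely_defined (ad (full_op (T n)) (op_closure A)))
  (f1_bdd : forall n, bounded_op (ad (full_op (T n)) (op_closure A)))
  (f2 : forall n y, dom (adjoint ip A) y ->
          dom (op_closure A0) (badj ip (T n) y))
  (hsup : exists M : R[i], forall n,
          op_norm_le (ad (full_op (T n)) (op_closure A)) M) :
  op_eq (op_closure A0) (adjoint ip A).
Proof.
have rf := rip_form hip.
have Ad := densely_defined_rip hip hA_dense.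
have adjA y z := adjointP hip y z hA_lin Ad.
(* Read symmetrically, [hA0] says that each [(x, A x)] satisfies the adjoint relation of [A0], which
   extends to the closure of the graph. *)
have A0adj y z : closure (graph A0) (y, z) -> adjoint_rel ip A y z.
  move=> h x dx; rewrite (rfC rf) (rfC rf x).
  apply/esym/(closure_graph_rip hip h) => y' dy'.
  rewrite (rfC rf) (rfC rf y'); apply/esym; move: x dx; apply/adjA.
  exact: hA0.
suff main y z : adjoint_rel ip A y z -> closure (graph A0) (y, z).
  have dE : dom (op_closure A0) = dom (adjoint ip A).
    apply/seteqP; split => y.
      by move=> [z /A0adj/adjA[]].
    by move=> dy; exists (app (adjoint ip A) y); apply/main/adjA.
  split => // y dy.
  (* Whatever value [xget] picks in the closure, [A0adj] identifies it with the adjoint. *)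
  by have /A0adj/adjA[_ ->] := xgetPex 0 dy.
move=> hyz; have [dy _] := (adjA y z).2 hyz.
pose yn n := badj ip (T n) y.
have /choice[k hk] n : exists w, closure (graph A0) (yn n, w) by exact: f2.
pose bn n := k n - badj ip (T n) z.
have ripT n := badjP hip (hT n).
have [M hM] := hsup.
have bn_le n : rip ip (bn n) (bn n) <= 10 * complex.Re M ^+ 2 * rip ip y y.
  have bx x s : dom (ad (full_op (T n)) (op_closure A)) x -> 0 < s ->
      rip ip x x <= s ->
      rip ip x (bn n) ^+ 2 <= complex.Re M ^+ 2 * s * rip ip y y.
    (* Here [h] and [h'] are values of the closure of [A] at [x] and at [T n x], so [T n h - h'] is
       the commutator at [x]. *)
    move=> [[[h hh] _] [_ [h' hh']]] s0 xs.
    have -> : rip ip x (bn n) = rip ip (T n h - h') y.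
      rewrite (rfBr rf) (rfB rf) ripT.
      rewrite (closure_graph_rip hip hh (A0adj _ _ (hk n))).
      by rewrite (closure_graph_rip hip hh' hyz) ripT.
    apply: le_trans (rf_Cauchy_Schwarz rf _ _) _.
    apply: ler_wpM2r; first exact: rf_ge0.
    exact: (ad_closure_bound hip hA_lin hA_clos (hT n) (hM n) s0 xs hh hh').
  have [->|b0] := eqVneq (rip ip (bn n) (bn n)) 0.
    apply: mulr_ge0; last exact: rf_ge0.
    by apply: mulr_ge0 => //; exact: sqr_ge0.
  have b_gt0 : 0 < rip ip (bn n) (bn n) by rewrite lt_def b0 (rf_ge0 rf).
  have b4 : 0 < rip ip (bn n) (bn n) / 4 by lra.
  (* With [q] the squared norm of [bn n], pick [x] in the commutator domain at squared distance
     below [q / 4]; then [rip x x <= 5 / 2 * q]. Splitting [bn n] at [x] gives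
     [q ^+ 2 <= 4 * a ^+ 2] for [a = rip x (bn n)], whence the constant 10. *)
  have [x dx hx] := densely_defined_rip hip (f1_dense n) (bn n) b4.
  have xs := rf_sqrD_le rf (bn n) (x - bn n).
  rewrite [bn n + _]addrC subrK (rfBC rf x) in xs.
  have {}xs : rip ip x x <= 5 / 2 * rip ip (bn n) (bn n) by lra.
  have s0 : 0 < 5 / 2 * rip ip (bn n) (bn n) by lra.
  have := bx _ _ dx s0 xs; have := rf_Cauchy_Schwarz rf (bn n - x) (bn n).
  have := ler_wpM2r (ltW b_gt0) (ltW hx).
  have qE : rip ip (bn n) (bn n) = rip ip x (bn n) + rip ip (bn n - x) (bn n).
    by rewrite (rfB rf (bn n) x); lra.
  have := sqr_ge0 (rip ip x (bn n) - rip ip (bn n - x) (bn n)).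
  rewrite sqrrB => sq h1 h2 h3.
  rewrite -(ler_pM2r b_gt0); move: (congr1 (fun t => t ^+ 2) qE) sq h1 h2 h3.
  rewrite /= sqrrD; set q := rip ip (bn n) (bn n); set a := rip ip x _.
  set c := rip ip _ (bn n); set d := rip ip (bn n - x) (bn n - x).
  set N := complex.Re M ^+ 2; set Y := rip ip y y => ? ? ? ? ?; lra.
have bn0 : forall v, rip ip (bn n) v @[n --> \oo] --> (0 : R).
  apply: (rip_weak_null hip Ad bn_le) => x dx.
  (* For [x] in the domain of [A], moving [A] and [T n] across the form turns [rip (bn n) x] into a
     sequence with this weak operator limit. *)
  have -> : (0 : R) = rip ip (app A x) y - rip ip x z.
    by rewrite hyz// subrr.
  have -> : (fun n => rip ip (bn n) x) =
      (fun n => rip ip (T n (app A x)) y - rip ip (T n x) z).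
    apply/funext => n; rewrite (rfB rf) !ripT (rfC rf) (rfC rf _ x).
    by rewrite -(A0adj _ _ (hk n))//.
  by apply: cvgB; exact: wot_rip.
have [w Gw hw] := projection_exists (pair_form_real_form hip) (y, z)
  (closure_graph_subspace hip hA0_lin) (closure_graph_complete hip (S := A0)).
set r := (y, z) - w in hw.
have r_yz : pair_form ip r (y, z) = 0.
  (* The left side is the pairing of [r] with [(yn n, k n)], which is constantly 0. *)
  have c1 : rip ip (T n r.1) y + (rip ip (T n r.2) z + rip ip (bn n) r.2)
      @[n --> \oo] --> rip ip r.1 y + (rip ip r.2 z + 0).
    by apply: cvgD; [exact: wot_rip|apply: cvgD => //; exact: wot_rip].
  rewrite addr0 in c1; apply: cvg_unique c1 _ => //=.
  have -> : (fun n => rip ip (T n r.1) y +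
      (rip ip (T n r.2) z + rip ip (bn n) r.2)) = fun=> 0.
    apply/funext => n; rewrite -[RHS](hw _ (hk n)) /pair_form /= !ripT.
    rewrite (rfC rf (bn n)) (rfBr rf (k n) (badj ip (T n) z)).
    by rewrite [rip ip r.2 _ + _]addrC subrK.
  exact: cvg_cst.
have : pair_form ip r r = 0.
  rewrite {2}/r (rfBr (pair_form_real_form hip)) r_yz hw//.
  by rewrite subrr.
rewrite /pair_form => rr.
have := rf_ge0 rf r.1; have := rf_ge0 rf r.2 => r2 r1.
have e1 : r.1 = 0 by apply: (rip_eq0 hip); lra.
have e2 : r.2 = 0 by apply: (rip_eq0 hip); lra.
suff -> : (y, z) = w by [].
by apply/eqP; rewrite -subr_eq0 -/r [r]surjective_pairing e1 e2.
Qed.
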